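(* For every integer $n\ge 0$, let $\mathcal{H}M_n$ denote the total number of humps, summed over all Motzkin paths of length $n$. Then \[ \mathcal{H}M_n=\frac{1}{2}\sum_{j\ge 1}\binom{n}{j}\binom{n-j}{j}. \]
   Context: A Motzkin path of length $n$ is a lattice path from $(0,0)$ to $(n,0)$ using flat-steps $(1,0)$, up-steps $(1,1)$ and down-steps $(1,-1)$ that never goes below the $x$-axis. A hump in a Motzkin path is a (contiguous) occurrence of an up-step, followed by zero or more flat-steps, followed by a down-step. *)

(* Defs.v *)
From HB Require Import structures.
From mathcomp Require Import all_boot all_order all_algebra.

Set Implicit Arguments.
Unset Strict Implicit.
Unset Printing Implicit Defensive.

Import Order.TTheory GRing.Theory Num.Theory.
Local Open Scope ring_scope.

Inductive step := Flat | Up | Down.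

Definition step_to_opt (s : step) : option bool :=
  match s with Flat => None | Up => Some true | Down => Some false end.

Definition opt_to_step (o : option bool) : step :=
  match o with None => Flat | Some true => Up | Some false => Down end.

Lemma step_to_optK : cancel step_to_opt opt_to_step.
Proof. by case. Qed.

HB.instance Definition _ := Finite.copy step (can_type step_to_optK).

Definition step_vec (s : step) : int * int :=
  match s with Flat => (1, 0) | Up => (1, 1) | Down => (1, -1) end.

Definition vertex (p : seq step) (k : nat) : int * int :=
  \sum_(s <- take k p) step_vec s.

(* Every step advances the abscissa by 1, so a path ending at (n, 0) has
   exactly n steps.  As the path is piecewise linear, it stays weakly above
   the x-axis iff all its vertices do. *)
Definition is_motzkin (n : nat) (p : n.-tuple step) : bool :=
  (vertex p n == (n%:Z, 0)) && [forall k : 'I_n.+1, 0 <= (vertex p k).2].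

Definition motzkin_paths (n : nat) : {set n.-tuple step} :=
  [set p | is_motzkin p].

Definition is_hump (n : nat) (p : n.-tuple step) (i j : 'I_n) : bool :=
  [&& (i < j)%N, tnth p i == Up, tnth p j == Down
    & [forall k : 'I_n, (i < k < j)%N ==> (tnth p k == Flat)]].

(* A contiguous occurrence of U F^k D is identified by the positions of its
   up-step and its down-step. *)
Definition num_humps (n : nat) (p : n.-tuple step) : nat :=
  #|[set ij : 'I_n * 'I_n | is_hump p ij.1 ij.2]|.

Definition total_humps (n : nat) : nat :=
  (\sum_(p in motzkin_paths n) num_humps p)%N.

(* Main.v *)
(* Let t(n, h) be the coefficient of x^h in (1/x + 1 + x)^n.  By reflection,
   there are W(m) = t(m, 0) - t(m, 2) Motzkin paths of length m.  Deleting a hump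
   leaves a shorter Motzkin path with a marked vertex, so the number of humps is
   the sum of (m + 1) W(m) over m <= n - 2.  Differentiating the (m + 1)-st power
   gives (m + 1) W(m) = t(m + 1, 1), hence
   2 (m + 1) W(m) = t(m + 1, 1) + t(m + 1, -1) = t(m + 2, 0) - t(m + 1, 0), and
   the sum telescopes to (t(n, 0) - 1) / 2.  Finally t(n, 0) is the coefficient of
   X^n in (1 + X (1 + X))^n. *)
Require Import Defs.
From HB Require Import structures.
From mathcomp Require Import all_boot all_order all_algebra.
From mathcomp Require Import ring zify.

Set Implicit Arguments.
Unset Strict Implicit.
Unset Printing Implicit Defensive.

Import Order.TTheory GRing.Theory Num.Theory.
Local Open Scope ring_scope.

(** * Trinomial coefficients [t(n, h)], written [trinom n h] *)

Fixpoint trinom (n : nat) (h : int) : int :=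
  if n is m.+1 then trinom m h + trinom m (h + 1) + trinom m (h - 1)
  else (h == 0)%:R.

Lemma trinomS n (h : int) :
  trinom n.+1 h = trinom n h + trinom n (h + 1) + trinom n (h - 1).
Proof. by []. Qed.

Lemma trinomN n (h : int) : trinom n (- h) = trinom n h.
Proof.
elim: n h => [|n IHn] h /=; first by rewrite oppr_eq0.
have -> : - h + 1 = - (h - 1) by ring.
have -> : - h - 1 = - (h + 1) by ring.
by rewrite !IHn addrAC.
Qed.

Lemma trinom_small n (h : int) : h < - n%:Z -> trinom n h = 0.
Proof.
elim: n h => [|n IHn] h hlt /=; first by case: eqP => // h0; lia.
by rewrite !IHn //; lia.
Qed.

(* Compare coefficients in [x (P^(n+1))' = (n+1) P^n (x - 1/x)], where
   [P = 1/x + 1 + x]. *)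
Lemma trinom_deriv n (h : int) :
  h * trinom n.+1 h = n.+1%:R * (trinom n (h - 1) - trinom n (h + 1)).
Proof.
elim: n h => [|n IHn] h.
  by rewrite /=; do ![case: eqP => ?]; lia.
have E0 := IHn h; have E1 := IHn (h + 1); have E2 := IHn (h - 1).
(* Replacing the factors [h + 1] and [h - 1] by [h] leaves [t(n+1, h-1) - t(n+1, h+1)], which raises
   the factor [n + 1] to [n + 2]. *)
have {}E1 : h * trinom n.+1 (h + 1) =
  n.+1%:R * (trinom n h - trinom n (h + 1 + 1)) - trinom n.+1 (h + 1).
  by rewrite -[in trinom n h](addrK 1 h) -E1; ring.
have {}E2 : h * trinom n.+1 (h - 1) =
  n.+1%:R * (trinom n (h - 1 - 1) - trinom n h) + trinom n.+1 (h - 1).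
  by rewrite -[in trinom n h](subrK 1 h) -E2; ring.
rewrite trinomS 2!mulrDr E0 E1 E2 !trinomS addrK subrK -[n.+2]addn1 natrD; ring.
Qed.

(** Multiplying [1/x + 1 + x] by [x] makes it a polynomial, at the price of shifting the index by
    [n]. *)
Lemma coef_trinom n k :
  ((1 + 'X * (1 + 'X)) ^+ n : {poly int})`_k = trinom n (k%:Z - n%:Z).
Proof.
elim: n k => [|n IHn] k.
  by rewrite expr0 coef1 subr0 /=; case: k.
rewrite exprS mulrDl mul1r -mulrA mulrDl mul1r coefD coefXM.
rewrite coefD coefXM !IHn /=.
have -> : k%:Z - n.+1%:Z + 1 = k%:Z - n%:Z by lia.
have -> : k%:Z - n.+1%:Z - 1 = k%:Z - 2 - n%:Z by lia.
have -> : k%:Z - n.+1%:Z = k%:Z - 1 - n%:Z by lia.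
rewrite [in RHS](addrC (trinom n (k%:Z - 1 - n%:Z))).
case: k => [|[|k]] /=.
- by rewrite !(@trinom_small n (_ - _ - _)) ?addr0 //; lia.
- by rewrite addrA (@trinom_small n (_ - 2 - _)) //; lia.
- by rewrite addrA; congr (_ + trinom _ _ + trinom _ _); lia.
Qed.

Lemma coef_1DX_exp (R : nzRingType) n k :
  ((1 + 'X) ^+ n : {poly R})`_k = 'C(n, k)%:R.
Proof.
elim: n k => [|n IHn] [|k]; rewrite ?expr0 ?coef1 // exprS mulrDl mul1r coefD.
  by rewrite coefXM IHn addr0 !bin0.
by rewrite coefXM !IHn binS natrD.
Qed.

Lemma trinom0E n :
  trinom n 0 = \sum_(0 <= j < n.+1) ('C(n, j) * 'C(n - j, j))%N%:R.
Proof.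
have -> : trinom n 0 = ((1 + 'X * (1 + 'X)) ^+ n : {poly int})`_n.
  by rewrite coef_trinom subrr.
(* After reversal the [j]-th term has exponent [n - j], so its factor [X^(n-j)] leaves the
   coefficient of [X^j] in [(1 + X)^(n-j)]. *)
rewrite exprDn coef_sum (reindex_inj rev_ord_inj) big_mkord /=.
apply: eq_bigr => j _; have le_jn : (j <= n)%N by rewrite -ltnS.
rewrite expr1n mul1r subSS coefMn exprMn coefXnM ltnNge leq_subr subKn //=.
by rewrite coef_1DX_exp bin_sub // mulnC natrM mulr_natr.
Qed.

(** * Recursive forms of the path condition and the hump count *)

Fixpoint stays_nonneg (h : int) (p : seq step) : bool :=
  if p is s :: q then (0 <= h) && stays_nonneg (h + (step_vec s).2) q
  else h == 0.

(** A cap is [F^k D]: an up-step opens a hump iff a cap follows it. *)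
Fixpoint starts_with_cap (p : seq step) : bool :=
  match p with
  | Flat :: q => starts_with_cap q
  | Down :: _ => true
  | _ => false
  end.

Fixpoint humps (p : seq step) : nat :=
  if p is s :: q then ((s == Up) && starts_with_cap q + humps q)%N else 0.

Lemma vertex0 p : vertex p 0 = 0.
Proof. by rewrite /vertex take0 big_nil. Qed.

Lemma vertex_cons s p k : vertex (s :: p) k.+1 = step_vec s + vertex p k.
Proof. by rewrite /vertex /= big_cons. Qed.

Lemma vertex_fst p k : (k <= size p)%N -> (vertex p k).1 = k%:Z.
Proof.
elim: p k => [|s p IHp] [|k] //=; rewrite ?vertex0 // ltnS => /IHp Ek.
by rewrite vertex_cons /= Ek; case: s => /=; lia.
Qed.

Lemma stays_nonnegE h p :
  stays_nonneg h p = (h + (vertex p (size p)).2 == 0) &&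
    all (fun k => 0 <= h + (vertex p k).2) (iota 0 (size p).+1).
Proof.
elim: p h => [|s p IHp] h.
  by rewrite /= vertex0 /= addr0 andbT; case: eqP => // ->.
have -> : iota 0 (size (s :: p)).+1 = 0%N :: map (addn 1) (iota 0 (size p).+1).
  by rewrite -iotaDl.
rewrite [size _]/= vertex_cons [all _ (_ :: _)]/= all_map vertex0 addr0.
rewrite [LHS]/= IHp andbCA; congr (_ && (_ && _)); first by rewrite addrA.
by apply: eq_all => k /=; rewrite vertex_cons /= addrA.
Qed.

Lemma is_motzkinE n (p : n.-tuple step) : is_motzkin p = stays_nonneg 0 p.
Proof.
rewrite /is_motzkin -pair_eqE /pair_eq /= vertex_fst ?size_tuple // eqxx.
rewrite stays_nonnegE size_tuple add0r; congr (_ && _).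
apply/forallP/allP => [H k | H k].
  by rewrite mem_iota add0n add0r => /andP[_ kn]; apply: (H (Ordinal kn)).
by rewrite -[leRHS]add0r; apply: H; rewrite mem_iota /=.
Qed.

Lemma sum_step (V : nmodType) (F : step -> V) :
  \sum_s F s = F Flat + F Up + F Down.
Proof.
rewrite (bigD1 Flat) // (bigD1 Up) // (bigD1 Down) //= big1 ?addr0 ?addrA //.
by case.
Qed.

Lemma sum_tuple_cons (V : nmodType) (T : finType) n (F : n.+1.-tuple T -> V) :
  \sum_p F p = \sum_x \sum_(q : n.-tuple T) F [tuple of x :: q].
Proof.
rewrite pair_bigA /=.
rewrite (reindex (fun xq : T * n.-tuple T => [tuple of xq.1 :: xq.2])) //=.
exists (fun p : n.+1.-tuple T => (thead p, [tuple of behead p])) => [[x q] _|p _].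
  by congr (_, _); apply/val_inj.
by rewrite /= -tuple_eta.
Qed.

Lemma forall_ord_recl n (P : pred 'I_n.+1) :
  [forall k, P k] = P ord0 && [forall k : 'I_n, P (lift ord0 k)].
Proof.
apply/forallP/andP => [H | [H0 /forallP H] k]; first by split=> //; apply/forallP.
by case: (unliftP ord0 k) => [j|] ->.
Qed.

Lemma forall_before_cons n s (q : n.-tuple step) (j : 'I_n) :
  [forall k : 'I_n.+1, (k < lift ord0 j)%N ==> (tnth [tuple of s :: q] k == Flat)]
  = (s == Flat) && [forall k : 'I_n, (k < j)%N ==> (tnth q k == Flat)].
Proof.
rewrite forall_ord_recl tnth0 /=; congr (_ && _).
by apply: eq_forallb => k; rewrite tnthS.
Qed.

(** Only the first non-flat step can satisfy the condition, so the sum is at most 1. *)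
Lemma sum_starts_with_cap n (q : n.-tuple step) :
  (\sum_(j < n) [&& tnth q j == Down
     & [forall k : 'I_n, (k < j)%N ==> (tnth q k == Flat)]])%N
  = starts_with_cap q.
Proof.
elim: n q => [|n IHn] q; first by rewrite big_ord0 tuple0.
case/tupleP: q => s q; rewrite big_ord_recl tnth0.
have -> : [forall k : 'I_n.+1,
    (k < @ord0 n)%N ==> (tnth [tuple of s :: q] k == Flat)] by apply/forallP.
rewrite andbT; under eq_bigr => j _ do rewrite tnthS forall_before_cons.
case: s => /=; first exact: IHn.
- by rewrite big1 // => j _; rewrite andbF.
- by rewrite big1 // => j _; rewrite andbF.
Qed.

Lemma num_humps_sum n (p : n.-tuple step) :
  num_humps p = (\sum_(i < n) \sum_(j < n) is_hump p i j)%N.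
Proof.
rewrite /num_humps -sum1_card pair_bigA big_mkcond /=.
by apply: eq_bigr => ij _; rewrite inE; case: is_hump.
Qed.

Lemma is_hump_lift n s (q : n.-tuple step) (i j : 'I_n) :
  is_hump [tuple of s :: q] (lift ord0 i) (lift ord0 j) = is_hump q i j.
Proof.
rewrite /is_hump !tnthS forall_ord_recl; congr [&& _, _, _ & _].
by apply: eq_forallb => k; rewrite tnthS.
Qed.

Lemma is_hump0_lift n s (q : n.-tuple step) (j : 'I_n) :
  is_hump [tuple of s :: q] ord0 (lift ord0 j) =
  [&& s == Up, tnth q j == Down
    & [forall k : 'I_n, (k < j)%N ==> (tnth q k == Flat)]].
Proof.
rewrite /is_hump tnth0 tnthS forall_ord_recl /=; congr [&& _, _ & _].
by apply: eq_forallb => k; rewrite tnthS.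
Qed.

Lemma num_humpsE n (p : n.-tuple step) : num_humps p = humps p.
Proof.
rewrite num_humps_sum; elim: n p => [|n IHn] p; first by rewrite big_ord0 tuple0.
case/tupleP: p => s q; rewrite big_ord_recl /=; congr (_ + _)%N.
  rewrite big_ord_recl add0n; under eq_bigr => j _ do rewrite is_hump0_lift.
  by case: (s == Up); [exact: sum_starts_with_cap | rewrite big1].
rewrite -IHn; apply: eq_bigr => i _; rewrite big_ord_recl add0n.
by apply: eq_bigr => j _; rewrite is_hump_lift.
Qed.

(** * Counting paths from height [h] to 0 by their first step *)

Definition num_paths n (h : int) : int :=
  \sum_(p : n.-tuple step) (stays_nonneg h p)%:R.

Definition num_cap_paths n (h : int) : int :=
  \sum_(p : n.-tuple step) (stays_nonneg h p && starts_with_cap p)%:R.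

Definition num_path_humps n (h : int) : int :=
  \sum_(p : n.-tuple step) (stays_nonneg h p * humps p)%N%:R.

Lemma sum_tuple0 (V : nmodType) (T : finType) (F : 0.-tuple T -> V) :
  \sum_p F p = F [tuple].
Proof. by rewrite (big_pred1 [tuple]) // => p; rewrite [p]tuple0; apply/esym/eqP. Qed.

Lemma num_paths0 h : num_paths 0 h = (h == 0)%:R.
Proof. by rewrite /num_paths sum_tuple0. Qed.

Lemma num_pathsS n (h : int) : 0 <= h ->
  num_paths n.+1 h = num_paths n h + num_paths n (h + 1) + num_paths n (h - 1).
Proof.
by move=> h0; rewrite /num_paths sum_tuple_cons sum_step /= h0 addr0.
Qed.

Lemma num_paths_lt0 n (h : int) : h < 0 -> num_paths n h = 0.
Proof.
move=> h0; rewrite /num_paths big1 // => -[[|s p] sz] _ /=.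
  by rewrite lt_eqF.
by rewrite leNgt h0.
Qed.

(* Reflection: [trinom n (h + 2)] counts the unrestricted paths from [h] to [0]
   that reach height [-1]. *)
Lemma num_pathsE n (h : int) : -1 <= h ->
  num_paths n h = trinom n h - trinom n (h + 2).
Proof.
elim: n h => [|n IHn] h h1.
  by rewrite num_paths0 /= (_ : (h + 2 == 0) = false) ?subr0 //; lia.
(* The boundary value [h = -1] is needed by the recursion at [h = 0]; there both sides vanish, by
   the symmetry of [trinom]. *)
have [h0|h0] := ltP h 0.
  have -> : h = - 1 by lia.
  by rewrite num_paths_lt0 // trinomN subrr.
rewrite num_pathsS // !IHn /=; try lia.
have -> : h + 1 + 2 = h + 2 + 1 by ring.
have -> : h - 1 + 2 = h + 1 by ring.
have -> : h + 2 - 1 = h + 1 by ring.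
ring.
Qed.

(** After the cap [F^k D] comes an arbitrary path from [h], of length [m = n - 1 - k]. *)
Lemma num_cap_pathsE n (h : int) : 0 <= h ->
  num_cap_paths n (h + 1) = \sum_(m < n) num_paths m h.
Proof.
move=> h0; elim: n => [|n IHn].
  by rewrite big_ord0 /num_cap_paths sum_tuple0 andbF.
rewrite big_ord_recr /= -IHn /num_cap_paths sum_tuple_cons sum_step /=.
rewrite addr0 addrK (_ : 0 <= h + 1) /=; last lia.
rewrite [X in _ + X + _]big1 => [|q _]; last by rewrite andbF.
by rewrite addr0; congr (_ + _); apply: eq_bigr => q _; rewrite andbT.
Qed.

(** A hump [U F^k D] can be inserted at any of the [m + 1] vertices of a path of length
    [m = n - 2 - k]. Induction on the first step replaces this bijection. *)
Lemma num_path_humpsE n (h : int) : -1 <= h ->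
  num_path_humps n h = \sum_(m < n.-1) m.+1%:R * num_paths m h.
Proof.
elim: n h => [|n IHn] h h1.
  by rewrite big_ord0 /num_path_humps sum_tuple0 muln0.
have [h0|h0] := ltP h 0.
  rewrite [RHS]big1 => [|m _]; last by rewrite num_paths_lt0 // mulr0.
  rewrite /num_path_humps big1 // => -[[|s p] //= sz] _ /=.
  by rewrite leNgt h0.
(* The last term counts the humps opened by the first step. *)
have -> : num_path_humps n.+1 h = num_path_humps n h + num_path_humps n (h + 1)
    + num_path_humps n (h - 1) + num_cap_paths n (h + 1).
  rewrite {1}/num_path_humps sum_tuple_cons sum_step /= h0 addr0 /=.
  rewrite [RHS]addrAC -!addrA [in RHS](addrA (num_path_humps n (h + 1))).
  congr (_ + (_ + _)).
  rewrite -big_split; apply: eq_bigr => q _ /=.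
  by rewrite mulnDr natrD mulnb addrC.
rewrite !IHn ?num_cap_pathsE //; try lia.
case: n {IHn} => [|n]; first by rewrite !big_ord0 !addr0.
(* Beyond [m = 0], the three sums combine to [m + 1] times the paths of length [m + 1], and the
   capped paths add one more copy. *)
rewrite /= ![\sum_(i < n.+1) _]big_ord_recl /= mul1r.
rewrite -!big_split addrCA -big_split /=; congr (_ + _).
apply: eq_bigr => m _; rewrite /bump /= add1n num_pathsS //.
rewrite -[m.+2]addn1 natrD; ring.
Qed.

(** * Telescoping and the final formula *)

Lemma trinom0_diff m :
  trinom m.+2 0 - trinom m.+1 0 = 2%:R * (m.+1%:R * num_paths m 0).
Proof.
have := trinom_deriv m 1; rewrite subrr mul1r => E.
rewrite num_pathsE // add0r -[2]/(1 + 1 : int) -E.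
rewrite trinomS sub0r add0r trinomN; ring.
Qed.

Lemma double_num_path_humps n : 2%:R * num_path_humps n 0 = trinom n 0 - 1.
Proof.
(* The sum telescopes down to [t(1, 0) = 1]; for [n = 0] it is empty and [t(0, 0) = 1]. *)
rewrite num_path_humpsE //; case: n => [|n]; first by rewrite big_ord0.
rewrite mulr_sumr /=; elim: n => [|n IHn]; first by rewrite big_ord0.
by rewrite big_ord_recr /= IHn -trinom0_diff /=; ring.
Qed.

Lemma total_humpsE n : (total_humps n)%:R = num_path_humps n 0.
Proof.
rewrite /total_humps /num_path_humps natr_sum big_mkcond /=.
apply: eq_bigr => p _; rewrite inE is_motzkinE num_humpsE.
by case: stays_nonneg; rewrite ?mul1n.
Qed.

(* The terms with j > n vanish, so the sum over j >= 1 is finite. *)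
Theorem theorem3p1 (n : nat) :
  (total_humps n)%:R =
    2%:R^-1 * \sum_(1 <= j < n.+1) ('C(n, j) * 'C(n - j, j))%N%:R :> rat.
Proof.
have E := double_num_path_humps n.
(* The term [j = 0] is 1 and cancels the [- 1]. *)
rewrite trinom0E big_nat_recl // bin0 subn0 bin0 muln1 addrC addKr -total_humpsE in E.
rewrite -natr_sum -natrM in E; move/eqP: E; rewrite eqr_nat => /eqP E.
by rewrite big_add1 -natr_sum -E natrM mulKf.
Qed.
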